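(* If $G$ is a connected nonbipartite graph of order $n$ and diameter $D$, then $$\mu(G)+\mu_{\min}(G)>\frac{2}{\mu^{2D}(G)\,n}.$$ Moreover, for all integers $k\geq 3$, $D\geq 4$, and $n=D+2k-1$, there exists a connected nonbipartite graph $G$ of order $n$ and diameter $D$ with $\mu(G)>k$ and $$\mu(G)+\mu_{\min}(G)<\frac{4}{(k-1)^{2D-4}}.$$
   Context: Graphs are finite, simple and undirected, with nonempty vertex set; the order of a graph is its number of vertices. $\mu(G)$ and $\mu_{\min}(G)$ denote the largest and the smallest eigenvalues of the adjacency matrix of $G$, and $\mu^{2D}(G)=(\mu(G))^{2D}$. The diameter is the maximum over pairs of vertices of the length of a shortest path joining them. *)

(* Defs.v *)
From HB Require Import structures.
From mathcomp Require Import all_boot all_order all_algebra.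
From mathcomp Require Import all_classical all_reals.

Set Implicit Arguments.
Unset Strict Implicit.
Unset Printing Implicit Defensive.

Import Order.TTheory GRing.Theory Num.Theory.

Local Open Scope ring_scope.

Record sgraph := SGraph {
  vertex :> finType;
  adj : rel vertex;
  adj_sym : symmetric adj;
  adj_irrefl : irreflexive adj;
  vertex_gt0 : (0 < #|vertex|)%N
}.

Definition order (G : sgraph) : nat := #|G|.

Definition connected (G : sgraph) : Prop :=
  forall x y : G, connect (@adj G) x y.

Definition bipartite (G : sgraph) : Prop :=
  exists A : {set G}, forall x y : G, adj x y -> (x \in A) != (y \in A).

(* [x :: p] is a path with [d] edges (no repeated vertex) from [x] to [y]. *)
Definition joined_by_path (G : sgraph) (d : nat) (x y : G) : bool :=
  [exists p : d.-tuple G,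
    [&& path (@adj G) x p, uniq (x :: p) & last x p == y]].

(* A path has fewer than [order G] edges, so the search is exhaustive; the
   value is [order G] if no path joins [x] and [y]. *)
Definition dist (G : sgraph) (x y : G) : nat :=
  find (fun d => joined_by_path d x y) (iota 0 (order G)).

Definition diameter (G : sgraph) : nat :=
  \max_(x : G) \max_(y : G) dist x y.

Definition adjmx (R : realType) (G : sgraph) : 'M[R]_#|G| :=
  \matrix_(i, j) (adj (enum_val i) (enum_val j))%:R.

(* The spectrum of a real symmetric matrix of positive size is finite and
   nonempty, so that this supremum and this infimum are attained. *)
Definition mu (R : realType) (G : sgraph) : R :=
  sup [set a : R | eigenvalue (adjmx R G) a]%classic.

Definition mu_min (R : realType) (G : sgraph) : R :=
  inf [set a : R | eigenvalue (adjmx R G) a]%classic.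

(* Main.v *)
Require Import Defs.
From HB Require Import structures.
From mathcomp Require Import all_boot all_order all_algebra.
From mathcomp Require Import all_classical all_reals.
From mathcomp Require Import topology normedtype derive.
From mathcomp Require Import zify ring lra.

Set Implicit Arguments.
Unset Strict Implicit.
Unset Printing Implicit Defensive.

Import Order.TTheory GRing.Theory Num.Theory.
Import numFieldNormedType.Exports.

Local Open Scope ring_scope.

(** Let [w > 0] be a Perron eigenvector of [G], let [x] be a unit eigenvector of
    [mu_min], and put [f = x / w].  The ground-state identity
      [mu + mu_min = 1/2 * sum over ordered adjacent (u, v) of
         w u * w v * (f u + f v) ^ 2]
    reads the gap as the energy of a network on the edges of the bipartite
    double cover of [G], with conductances [w u * w v] ([energy_identity]).
    Along a closed walk of odd length from [u] the quantities [f + f'] have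
    alternating sum [2 f u], so a vertex [u] where [x u ^ 2 >= 1 / n] forces
    energy, by Cauchy-Schwarz, as soon as the walk has small total resistance.
    A shortest odd closed walk at [u] has length [L <= 2D + 1], because [G] is
    not bipartite, and it is a path in the double cover
    ([shortest_odd_closed_walk]); so every edge of [G] is charged at most twice.

    The resistance of the walk, scaled by the values of [w] at its two ends,
    is bounded by a Chebyshev-type recursion.  Consecutive neighbours on the
    walk are distinct, so [w (v i) + w (v (i + 2)) <= mu * w (v (i + 1))], and
    then the scaled resistance [S] of initial segments satisfies
    [S (n + 2) + S n <= mu * S (n + 1)] ([resistance_step]).  As [S 0 = 0] and
    [S 1 = 1], this gives [S L < mu ^ (L - 1) <= mu ^ (2 D)], and the
    inequality follows.

    For the second half take [K_{k,k}], attach to one of its vertices a path,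
    and end the path with a triangle.  This is a path of independent sets with
    complete joins between consecutive ones, apart from the edge joining the two
    vertices of level 0.  Flipping the signs of the unit Perron vector [w] on
    odd levels gives a test vector that shows [mu + mu_min <= 4 w0 w1], where
    [w0] and [w1] are the entries at the ends of that edge
    ([level_graph_mu_min_le]).  As [mu > k], the eigenvalue equation makes [w]
    grow by a factor at least [mu - 1] at each of the [D - 2] steps towards
    [K_{k,k}], where it is at most 1 ([geometric_growth]). *)

(** * Rayleigh quotients of symmetric forms and the spectrum of a graph *)

Definition form (R : realType) (T : finType) (a : T -> T -> R) (x y : T -> R) :=
  \sum_u \sum_v a u v * (x u * y v).

Definition sqnorm (R : realType) (T : finType) (x : T -> R) := \sum_u x u ^+ 2.

Lemma sqnorm_ge0 (R : realType) (T : finType) (x : T -> R) : 0 <= sqnorm x.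
Proof. by apply: sumr_ge0 => u _; exact: sqr_ge0. Qed.

Lemma sqnorm_eq0 (R : realType) (T : finType) (x : T -> R) :
  sqnorm x = 0 -> forall u, x u = 0.
Proof.
move=> /eqP; rewrite psumr_eq0 => [/allP x0 u|u _]; last exact: sqr_ge0.
by apply/eqP; have := x0 u (mem_index_enum u); rewrite sqrf_eq0.
Qed.

Lemma sum_continuous (R : realType) n (I : finType) (F : I -> 'rV[R]_n -> R) :
  (forall i, continuous (F i)) -> continuous (fun x => \sum_i F i x).
Proof.
move=> Fc; apply: continuous_big => [|i _]; last exact: Fc.
exact: add_continuous.
Qed.

(** The unit sphere is compact. *)
Lemma unit_max (R : realType) (T : finType) (t0 : T) (a : T -> T -> R) :
  exists2 w : T -> R, sqnorm w = 1 &
    forall x : T -> R, sqnorm x = 1 -> form a x x <= form a w w.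
Proof.
pose fn (v : 'rV[R]_#|T|) (u : T) := v ord0 (enum_rank u).
pose S := [set v : 'rV[R]_#|T| | sqnorm (fn v) = 1]%classic.
have coordc u : continuous (fn^~ u) by exact: coord_continuous.
have cM (f g : 'rV[R]_#|T| -> R) :
    continuous f -> continuous g -> continuous (fun v => f v * g v).
  by move=> cf cg v; apply: continuousM; [exact: cf|exact: cg].
have nc : continuous (fun v => sqnorm (fn v)).
  apply: sum_continuous => u; exact: cM (coordc u) (coordc u).
have bc : continuous (fun v => form a (fn v) (fn v)).
  apply: (@sum_continuous _ _ _ (fun u v => \sum_z a u z * (fn v u * fn v z))) => u.
  apply: (@sum_continuous _ _ _ (fun z v => a u z * (fn v u * fn v z))) => z.
  by apply: (cM) => [|]; [exact: cst_continuous | apply: cM; exact: coordc].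
have row (x : T -> R) : exists v, fn v = x.
  exists (\row_i x (enum_val i)); apply/funext => u.
  by rewrite /fn mxE enum_rankK.
have S0 : (S !=set0)%classic.
  have [v vE] := row (fun u => (u == t0)%:R); exists v.
  rewrite /S /= vE /sqnorm (bigD1 t0) //= eqxx expr1n big1 ?addr0 // => u.
  by move=> /negbTE ->; rewrite expr0n.
have Sc : compact S.
  apply: (@subclosed_compact _ _
    [set v : 'rV[R]_#|T| | forall i, (`[-1, 1]%classic : set R) (v ord0 i)]%classic).
  - have nc' : {in (~` ((fun v => sqnorm (fn v)) @^-1` [set y : R | y = 1]))%classic,
        continuous (fun v => sqnorm (fn v))} by move=> v _; exact: nc.
    exact: (preimage_closed nc' (@closed_eq R 1)).
  - exact: (@rV_compact R _ _ (fun=> @segment_compact _ _ _)).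
  - move=> v v1 i; rewrite /= in_itv /= -ler_norml -(@expr_le1 _ 2) //.
    rewrite real_normK ?num_real // -[leRHS]v1 /sqnorm.
    rewrite (bigD1 (enum_val i)) //= /fn enum_valK.
    by rewrite lerDl sumr_ge0 // => u _; exact: sqr_ge0.
have [w wS wmax] := compact_EVT_max S0 Sc (continuous_subspaceT bc).
exists (fn w); first by move: wS; rewrite inE.
by move=> x x1; have [v vE] := row x; rewrite -vE; apply: wmax; rewrite inE /S /= vE.
Qed.

Lemma quadratic_ge0 (R : realType) (b c : R) :
  (forall t, 0 <= t * b + t ^+ 2 * c) -> b = 0.
Proof.
move=> H; apply/eqP; apply/contraT => b0.
have c1 : 0 < 1 + `|c| by rewrite ltr_pwDl.
(* The denominator 1 + |c| makes the quadratic term smaller than the linear one. *)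
have := H (- b / (1 + `|c|)).
rewrite [_ ^+ 2]expr2.
have -> : - b / (1 + `|c|) * b + - b / (1 + `|c|) * (- b / (1 + `|c|)) * c =
   b ^+ 2 * (c - (1 + `|c|)) / (1 + `|c|) ^+ 2 by field; rewrite gt_eqF.
rewrite pmulr_lge0 ?invr_gt0 ?exprn_gt0 // pmulr_rge0; last by rewrite exprn_even_gt0.
by have := ler_norm c; lra.
Qed.

(** The form [M |x|^2 - a x x] is nonnegative and vanishes at [w], so its first
    variation at [w] vanishes in every direction; the direction [M w - a w]
    suffices. *)
Lemma maximizer_eigen (R : realType) (T : finType) (a : T -> T -> R) M (w : T -> R) :
  (forall u v, a u v = a v u) -> (forall x, form a x x <= M * sqnorm x) ->
  form a w w = M * sqnorm w -> forall u, \sum_v a u v * w v = M * w u.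
Proof.
move=> sym le wM.
(* r is the residual of the eigenvalue equation, used as the direction of variation. *)
pose r u := M * w u - \sum_v a u v * w v.
suff r0 : sqnorm r = 0.
  by move=> u; apply/esym/eqP; rewrite -subr_eq0; apply/eqP; exact: (sqnorm_eq0 r0).
suff : 2 * sqnorm r = 0 by lra.
apply: (@quadratic_ge0 _ _ (M * sqnorm r - form a r r)) => t.
have := le (fun u => w u + t * r u); rewrite -subr_ge0.
suff -> : M * sqnorm (fun u => w u + t * r u)
   - form a (fun u => w u + t * r u) (fun u => w u + t * r u) =
   t * (2 * sqnorm r) + t ^+ 2 * (M * sqnorm r - form a r r) by [].
have -> : sqnorm (fun u => w u + t * r u) =
    sqnorm w + 2 * t * (\sum_u w u * r u) + t ^+ 2 * sqnorm r.
  rewrite /sqnorm !mulr_sumr -!big_split; apply: eq_bigr => u _ /=; ring.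
have -> : form a (fun u => w u + t * r u) (fun u => w u + t * r u) =
    form a w w + t * form a w r + t * form a r w + t ^+ 2 * form a r r.
  rewrite /form !mulr_sumr -!big_split; apply: eq_bigr => u _ /=.
  rewrite !mulr_sumr -!big_split; apply: eq_bigr => v _ /=; ring.
have wr : form a w r = form a r w.
  rewrite /form exchange_big; apply: eq_bigr => u _; apply: eq_bigr => v _.
  by rewrite sym; ring.
have rw : form a r w = M * (\sum_u w u * r u) - sqnorm r.
  rewrite /form /sqnorm mulr_sumr -sumrB; apply: eq_bigr => u _.
  rewrite (_ : \sum_v _ = r u * \sum_v a u v * w v); last first.
    by rewrite mulr_sumr; apply: eq_bigr => v _; ring.
  have -> : \sum_v a u v * w v = M * w u - r u by rewrite /r; ring.
  by ring.
by rewrite wr rw wM; ring.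
Qed.

Lemma rayleigh_max (R : realType) (T : finType) (t0 : T) (a : T -> T -> R) :
  (forall u v, a u v = a v u) ->
  exists (w : T -> R) (M : R),
    [/\ sqnorm w = 1, forall u, \sum_v a u v * w v = M * w u &
        forall x, form a x x <= M * sqnorm x].
Proof.
move=> sym; have [w w1 wmax] := unit_max t0 a.
pose M := form a w w; exists w, M.
have le x : form a x x <= M * sqnorm x.
  have := sqnorm_ge0 x; rewrite le_eqVlt => /orP[/eqP/esym x0|xp].
    have z := sqnorm_eq0 x0; rewrite x0 mulr0 /form big1 // => u _.
    by rewrite big1 // => v _; rewrite z mul0r mulr0.
  set s := sqnorm x in xp *; pose y u := (Num.sqrt s)^-1 * x u.
  have ss : (Num.sqrt s)^-1 ^+ 2 = s^-1 by rewrite exprVn sqr_sqrtr // ltW.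
  have y1 : sqnorm y = 1.
    rewrite /sqnorm /y; under eq_bigr => u _ do rewrite exprMn ss.
    by rewrite -mulr_sumr mulVf // gt_eqF.
  have := wmax _ y1; suff -> : form a y y = s^-1 * form a x x.
    by rewrite mulrC ler_pdivrMr.
  rewrite /form mulr_sumr; apply: eq_bigr => u _; rewrite mulr_sumr.
  by apply: eq_bigr => v _; rewrite /y -ss; ring.
by split=> //; apply: maximizer_eigen => //; rewrite w1 mulr1.
Qed.

Definition adjf (R : realType) (G : sgraph) (u v : G) : R := (adj u v)%:R.

Lemma adjfC (R : realType) (G : sgraph) (u v : G) : adjf R u v = adjf R v u.
Proof. by rewrite /adjf adj_sym. Qed.

Lemma adjf_ge0 (R : realType) (G : sgraph) (u v : G) : 0 <= adjf R u v.
Proof. exact: ler0n. Qed.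

(** Passes between row vectors indexed by the enumeration of the vertices and
    functions on the vertices; the symmetry of [adj] exchanges left and right
    eigenvectors. *)
Lemma graph_eigenvalueP (R : realType) (G : sgraph) (c : R) :
  eigenvalue (adjmx R G) c <->
  exists2 x : G -> R, (exists u, x u != 0) &
    forall u, \sum_v adjf R u v * x v = c * x u.
Proof.
split.
  move=> /eigenvalueP[z zE z0].
  exists (fun u => z ord0 (enum_rank u)).
    have /rV0Pn[i zi] := z0.
    by exists (enum_val i); rewrite enum_valK.
  move=> u; move/matrixP: zE => /(_ ord0 (enum_rank u)); rewrite !mxE => <-.
  rewrite (reindex (@enum_val G predT)) /=; last first.
    by exists enum_rank => ? _; rewrite ?enum_valK ?enum_rankK.
  apply: eq_bigr => i _; rewrite !mxE enum_valK enum_rankK /adjf adj_sym; ring.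
move=> [x [u xu] xE]; apply/eigenvalueP.
exists (\row_i x (enum_val i)); last first.
  by apply/rV0Pn; exists (enum_rank u); rewrite mxE enum_rankK.
apply/rowP => i; rewrite !mxE -xE.
rewrite [RHS](reindex (@enum_val G predT)) /=; last first.
  by exists enum_rank => ? _; rewrite ?enum_valK ?enum_rankK.
by apply: eq_bigr => j _; rewrite !mxE /adjf adj_sym; ring.
Qed.

Lemma form_eigen (R : realType) (T : finType) (a : T -> T -> R) (x : T -> R) c :
  (forall u, \sum_v a u v * x v = c * x u) -> form a x x = c * sqnorm x.
Proof.
move=> xE; rewrite /form /sqnorm mulr_sumr; apply: eq_bigr => u _.
rewrite expr2 mulrCA -xE mulr_sumr; apply: eq_bigr => v _.
by ring.
Qed.

Lemma sqnorm1_neq0 (R : realType) (T : finType) (x : T -> R) :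
  sqnorm x = 1 -> exists u, x u != 0.
Proof.
move=> x1; apply: contrapT => /forallNP x0; move: x1; rewrite /sqnorm big1.
  by move=> /esym/eqP; rewrite oner_eq0.
by move=> u _; have /negP := x0 u; rewrite negbK => /eqP ->; rewrite expr0n.
Qed.

Lemma sqnorm_gt0 (R : realType) (T : finType) (x : T -> R) u :
  x u != 0 -> 0 < sqnorm x.
Proof.
rewrite lt_neqAle sqnorm_ge0 andbT => xu.
by apply: contra_neq xu => /esym x0; exact: sqnorm_eq0.
Qed.

Lemma mu_spec (R : realType) (G : sgraph) :
  exists w : G -> R,
    [/\ sqnorm w = 1, forall u, \sum_v adjf R u v * w v = mu R G * w u &
        forall x : G -> R, form (@adjf R G) x x <= mu R G * sqnorm x].
Proof.
have /card_gt0P[t0 _] := vertex_gt0 G.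
have [w [M [w1 wE le]]] := rayleigh_max t0 (@adjfC R G).
suff -> : mu R G = M by exists w.
have Mev : eigenvalue (adjmx R G) M.
  by apply/graph_eigenvalueP; exists w => //; exact: sqnorm1_neq0.
have Mub : ubound [set c : R | eigenvalue (adjmx R G) c]%classic M.
  move=> c /graph_eigenvalueP[x [u xu] xE].
  by have := le x; rewrite (form_eigen xE) ler_pM2r // (sqnorm_gt0 xu).
apply/eqP; rewrite eq_le; apply/andP; split; first by apply: ge_sup => //; exists M.
by apply: ub_le_sup => //; exists M.
Qed.

Lemma mu_min_spec (R : realType) (G : sgraph) :
  exists w : G -> R,
    [/\ sqnorm w = 1, forall u, \sum_v adjf R u v * w v = mu_min R G * w u &
        forall x : G -> R, mu_min R G * sqnorm x <= form (@adjf R G) x x].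
Proof.
have /card_gt0P[t0 _] := vertex_gt0 G.
have symN (u v : G) : - adjf R u v = - adjf R v u by rewrite adjfC.
have [w [M [w1 wNE leN]]] := rayleigh_max t0 symN.
have wE u : \sum_v adjf R u v * w v = - M * w u.
  by rewrite mulNr -wNE -sumrN; apply: eq_bigr => v _; rewrite mulNr opprK.
have ge x : - M * sqnorm x <= form (@adjf R G) x x.
  rewrite mulNr lerNl; apply: le_trans (leN x); rewrite le_eqVlt; apply/orP; left.
  apply/eqP; rewrite /form -sumrN; apply: eq_bigr => u _; rewrite -sumrN.
  by apply: eq_bigr => v _; rewrite mulNr.
suff -> : mu_min R G = - M by exists w.
have Mev : eigenvalue (adjmx R G) (- M).
  by apply/graph_eigenvalueP; exists w => //; exact: sqnorm1_neq0.
have Mlb : lbound [set c : R | eigenvalue (adjmx R G) c]%classic (- M).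
  move=> c /graph_eigenvalueP[x [u xu] xE].
  by have := ge x; rewrite (form_eigen xE) ler_pM2r // (sqnorm_gt0 xu).
apply/eqP; rewrite eq_le; apply/andP; split.
  by apply: ge_inf => //; exists (- M).
by apply: lb_le_inf => //; exists (- M).
Qed.

(** * Perron vectors, energy and resistance *)

(** Replacing an extremal vector by its absolute value does not decrease the
    form, so the absolute value is an eigenvector too; its zero set is closed
    under adjacency, hence empty. *)
Lemma perron (R : realType) (G : sgraph) : Defs.connected G ->
  exists w : G -> R,
    [/\ sqnorm w = 1, forall u, \sum_v adjf R u v * w v = mu R G * w u &
        forall u, 0 < w u].
Proof.
move=> conG; have [z [z1 zE le]] := mu_spec R G.
pose w (u : G) := `|z u|.
have w1 : sqnorm w = 1.
  by rewrite -z1; apply: eq_bigr => u _; rewrite real_normK ?num_real.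
have wE : forall u, \sum_v adjf R u v * w v = mu R G * w u.
  apply: (maximizer_eigen (@adjfC R G) le); apply/eqP; rewrite eq_le le /=.
  rewrite w1 -z1 -(form_eigen zE); apply: ler_sum => u _; apply: ler_sum => v _.
  by rewrite ler_wpM2l ?adjf_ge0 // -normrM ler_norm.
have w0 u : 0 <= w u by exact: normr_ge0.
exists w; split=> // u; rewrite lt_neqAle w0 andbT; apply/eqP => /esym u0.
have step (x y : G) : w x = 0 -> adj x y -> w y = 0.
  move=> x0 xy; have := wE x; rewrite x0 mulr0 => /eqP.
  rewrite psumr_eq0 => [/allP /(_ y (mem_index_enum y))|v _].
    by rewrite /= /adjf xy mul1r => /eqP.
  by rewrite mulr_ge0 ?adjf_ge0.
have [v] := sqnorm1_neq0 w1; case/eqP.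
have /connectP[p] := conG u v.
elim: p u u0 => [|y p IH] x x0 /=; first by move=> _ ->.
by move=> /andP[/(step _ _ x0) y0]; exact: IH.
Qed.

Lemma mu_ge1 (R : realType) (G : sgraph) (x y : G) :
  Defs.connected G -> adj x y -> 1 <= mu R G.
Proof.
move=> conG xy; have [w [_ wE w0]] := perron R conG.
have ge u v : adj u v -> w v <= mu R G * w u.
  move=> uv; rewrite -wE (bigD1 v) //= {1}/adjf uv mul1r lerDl sumr_ge0 // => z _.
  by rewrite mulr_ge0 ?adjf_ge0 // ltW.
have := ge _ _ xy; have := ge y x; rewrite adj_sym => /(_ xy) h1 h2.
have := w0 x; have := w0 y => wx wy.
rewrite -(@ler_pM2r _ (w x + w y)) ?addr_gt0 //; lra.
Qed.

Lemma adjacent_pair_le (R : realType) (G : sgraph) (w : G -> R) (c : R) (x y z : G) :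
  (forall u, \sum_v adjf R u v * w v = c * w u) -> (forall u, 0 < w u) ->
  adj x y -> adj y z -> x != z -> w x + w z <= c * w y.
Proof.
move=> wE w0 xy yz xz; rewrite -wE (bigD1 x) //= (bigD1 z) 1?eq_sym //=.
rewrite {1 2}/adjf (@adj_sym G y x) xy yz !mul1r addrA lerDl sumr_ge0 // => v _.
by rewrite mulr_ge0 ?adjf_ge0 // ltW.
Qed.

(** Expanding the square, the two diagonal terms sum to [c |x|^2] each by the
    eigenvalue equation of [w], and the cross terms form [2 x A x]. *)
Lemma energy_identity (R : realType) (G : sgraph) (w x : G -> R) (c : R) :
  (forall u, \sum_v adjf R u v * w v = c * w u) -> (forall u, 0 < w u) ->
  \sum_u \sum_v adjf R u v * (w u * w v) * (x u / w u + x v / w v) ^+ 2 =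
  2 * (c * sqnorm x + form (@adjf R G) x x).
Proof.
move=> wE w0.
have wN u : w u != 0 by rewrite gt_eqF.
pose h (u v : G) := adjf R u v * w v * (x u ^+ 2 / w u).
have hE : \sum_u \sum_v h u v = c * sqnorm x.
  rewrite /sqnorm mulr_sumr; apply: eq_bigr => u _.
  by rewrite -mulr_suml wE; field.
have hE' : \sum_u \sum_v h v u = c * sqnorm x by rewrite exchange_big.
rewrite mulrDr [2 * (c * _)]mulr_natl mulr2n -{1}hE -hE' /form mulr_sumr -!big_split.
apply: eq_bigr => u _ /=; rewrite mulr_sumr -!big_split; apply: eq_bigr => v _ /=.
by rewrite /h (adjfC R v u); field; rewrite !wN.
Qed.

(** Cauchy-Schwarz in network form: potential drops [a i] across conductances
    [c i] in series dissipate at least the squared total drop divided by the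
    total resistance.  It is the nonnegativity of the energy left after
    subtracting from each drop its share [A / S / c i]. *)
Lemma weighted_cauchy (R : realType) (I : finType) (c a : I -> R) :
  (forall i, 0 < c i) ->
  (\sum_i a i) ^+ 2 <= (\sum_i c i * a i ^+ 2) * \sum_i (c i)^-1.
Proof.
move=> c0; set A := \sum_i a i; set Q := \sum_i _ * _; set S := \sum_i (c i)^-1.
have [i0 _|I0] := pickP I; last first.
  by rewrite /A /Q /S !big_pred0 // expr0n mul0r.
have S0 : 0 < S.
  rewrite /S (bigD1 i0) //= ltr_pwDl ?invr_gt0 // sumr_ge0 // => i _.
  by rewrite invr_ge0 ltW.
pose d := A / S.
have : 0 <= \sum_i c i * (a i - d / c i) ^+ 2.
  by rewrite sumr_ge0 // => i _; rewrite mulr_ge0 ?sqr_ge0 // ltW.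
have -> : \sum_i c i * (a i - d / c i) ^+ 2 = Q - 2 * d * A + d ^+ 2 * S.
  rewrite /Q /A /S !mulr_sumr -sumrB -big_split; apply: eq_bigr => i _ /=.
  by field; rewrite gt_eqF.
have -> : Q - 2 * d * A + d ^+ 2 * S = (Q * S - A ^+ 2) / S.
  by rewrite /d; field; rewrite gt_eqF.
by rewrite pmulr_lge0 ?invr_gt0 // subr_ge0.
Qed.

Lemma subsum_inj_le (R : realType) (I J : finType) (g : I -> J) (F : J -> R) :
  injective g -> (forall j, 0 <= F j) -> \sum_i F (g i) <= \sum_j F j.
Proof.
move=> ginj F0; have -> : \sum_i F (g i) = \sum_(j in g @: [set: I]) F j.
  by rewrite big_imset /= => [|? ? _ _ /ginj //]; apply: eq_bigl => i; rewrite inE.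
by rewrite [leRHS](bigID (mem (g @: [set: I]))) /= lerDl sumr_ge0.
Qed.

Lemma telescope_odd (R : realType) (f : nat -> R) L :
  \sum_(i < L) (-1) ^+ i * (f i + f i.+1) = f 0%N - (-1) ^+ L * f L.
Proof.
elim: L => [|L IH]; first by rewrite big_ord0 expr0 mul1r subrr.
by rewrite big_ord_recr /= IH exprS; ring.
Qed.

(** For a sequence with [w i + w i.+2 = m * w i.+1] and [n > 0] this is the value
    at [m / 2] of the Chebyshev polynomial of the second kind of degree [n.-1];
    the factors [w 0] and [w n] clear its denominators. *)
Definition scaled_resistance (R : realType) (w : nat -> R) n :=
  w 0%N * w n * \sum_(i < n) (w i * w i.+1)^-1.

(** Only the factor [w n.+2] is estimated, by [m * w n.+1 - w n]; the rest is
    the identity behind the telescoping of Casoratians. *)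
Lemma resistance_step (R : realType) (w : nat -> R) (m : R) n :
  (forall i, 0 < w i) -> w n + w n.+2 <= m * w n.+1 ->
  scaled_resistance w n.+2 + scaled_resistance w n <= m * scaled_resistance w n.+1.
Proof.
move=> w0 wn; rewrite /scaled_resistance !big_ord_recr /=.
set s := \sum_(i < n) _.
have wN i : w i != 0 by rewrite gt_eqF.
set t := s + (w n * w n.+1)^-1.
have t0 : 0 <= t.
  by rewrite addr_ge0 ?sumr_ge0 // => [i _|]; rewrite invr_ge0 mulr_ge0 // ltW.
have h : w 0%N * t * w n.+2 <= w 0%N * t * (m * w n.+1 - w n).
  by apply: ler_wpM2l; [rewrite mulr_ge0 // ltW|rewrite lerBrDl].
rewrite -subr_ge0 in h; rewrite -subr_ge0; apply: (le_trans h).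
by rewrite le_eqVlt; apply/orP; left; apply/eqP; rewrite /t; field; rewrite !wN.
Qed.

(** For the scaled resistance [S], the first step gives [S 2 <= m] and every
    later step loses a positive term, which makes the bound strict from length 3
    on. *)
Lemma resistance_lt (R : realType) (w : nat -> R) (m : R) n :
  0 < m -> (forall i, 0 < w i) ->
  (forall i, (i < n.+2)%N -> w i + w i.+2 <= m * w i.+1) ->
  scaled_resistance w n.+3 < m ^+ n.+2.
Proof.
move=> m0 w0; have S0 i : 0 < scaled_resistance w i.+1.
  rewrite /scaled_resistance mulr_gt0 ?mulr_gt0 // big_ord_recr ltr_wpDl ?invr_gt0 ?mulr_gt0 //.
  by rewrite sumr_ge0 // => j _; rewrite invr_ge0 mulr_ge0 // ltW.
have step i : w i.+1 + w i.+3 <= m * w i.+2 ->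
    scaled_resistance w i.+3 < m * scaled_resistance w i.+2.
  by move=> /(resistance_step w0); apply: lt_le_trans; rewrite ltrDl.
elim: n => [|n IH] wle.
  rewrite expr2; apply: lt_le_trans (step _ (wle _ _)) _ => //; rewrite ler_pM2l //.
  have := resistance_step w0 (wle 0%N isT).
  rewrite /scaled_resistance big_ord0 mulr0 addr0 => /le_trans; apply.
  by rewrite big_ord1 mulfV ?mulr1 // mulf_neq0 // gt_eqF.
apply: lt_trans (step _ (wle _ _)) _ => //.
rewrite exprS ltr_pM2l //; apply: IH => i ilt; exact/wle/ltnW.
Qed.

(** * Paths, distances and odd closed walks *)

Lemma dist_le (G : sgraph) (x y : G) p :
  path (@adj G) x p -> last x p = y -> (dist x y <= size p)%N.
Proof.
move=> pp; case: (shortenP pp) => q qp uq qsub qE.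
have szq : (size q <= size p)%N.
  by apply: uniq_leq_size qsub; case/andP: uq.
apply: leq_trans szq; rewrite leqNgt; apply/negP => lt.
have szG : (size q < Defs.order G)%N.
  by rewrite -[(size q).+1]/(size (x :: q)) -(card_uniqP uq); exact: max_card.
have := before_find 0%N lt; rewrite nth_iota // add0n => /negbT/negP; apply.
apply/existsP; exists (in_tuple q); apply/and3P; split=> //=.
exact/eqP.
Qed.

(** The search defining [dist] succeeds, since a shortened path between [x] and
    [y] has fewer than [order G] edges. *)
Lemma dist_path (G : sgraph) (x y : G) : Defs.connected G ->
  exists p, [/\ path (@adj G) x p, last x p = y & size p = dist x y].
Proof.
move=> conG; have /connectP[p0 p0p yE] := conG x y.
have [q [qp uq qE]] : exists q, [/\ path (@adj G) x q, uniq (x :: q) & last x q = y].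
  by case: (shortenP p0p) yE => q qp uq _ yq; exists q.
have : has (fun d => joined_by_path d x y) (iota 0 (Defs.order G)).
  apply/hasP; exists (size q).
    rewrite mem_iota add0n /= -[(size q).+1]/(size (x :: q)) -(card_uniqP uq).
    exact: max_card.
  by apply/existsP; exists (in_tuple q); apply/and3P; split=> //; apply/eqP.
move=> hs; have := nth_find 0%N hs; rewrite nth_iota; last by rewrite -[leqRHS](size_iota 0) -has_find.
rewrite add0n => /existsP[p /and3P[pp _ /eqP pE]].
by exists p; rewrite size_tuple.
Qed.

Lemma dist_le_diameter (G : sgraph) (x y : G) : (dist x y <= diameter G)%N.
Proof.
by rewrite /diameter (leq_trans _ (leq_bigmax x)) // (leq_trans _ (leq_bigmax y)).
Qed.

Definition odd_closed_walk (G : sgraph) (u : G) L :=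
  odd L && [exists p : L.-tuple G, path (@adj G) u p && (last u p == u)].

Lemma odd_closed_walkP (G : sgraph) (u : G) L :
  reflect (exists p, [/\ path (@adj G) u p, last u p = u, size p = L & odd L])
          (odd_closed_walk u L).
Proof.
apply: (iffP andP) => [[oL /existsP[p /andP[pp /eqP pu]]]|[p [pp pu <- op]]].
  by exists p; rewrite size_tuple.
by split=> //; apply/existsP; exists (in_tuple p); rewrite /= pp pu eqxx.
Qed.

(** The vertices at odd distance from [u] do not form one side of a bipartition,
    so some edge joins two vertices whose distances to [u] have equal parity; two
    geodesics and this edge close up. *)
Lemma odd_closed_walk_exists (G : sgraph) (u : G) :
  Defs.connected G -> ~ bipartite G ->
  exists2 L, odd_closed_walk u L & (L <= (2 * diameter G).+1)%N.
Proof.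
move=> conG nbip.
have [x [y [xy sameP]]] : exists x y : G, adj x y /\ odd (dist u x) = odd (dist u y).
  apply: contrapT => no; apply: nbip; exists [set v | odd (dist u v)] => x y xy.
  by rewrite !inE; apply/eqP => same; apply: no; exists x, y.
have [p [pp px psz]] := dist_path u x conG.
have [q [qp qy qsz]] := dist_path u y conG.
have rq : path (@adj G) y (rev (belast u q)) /\ last y (rev (belast u q)) = u.
  split; last first.
    by case: q qy {qp qsz} => [|z s] // _; rewrite [belast _ _]/= rev_cons last_rcons.
  by rewrite -qy rev_path; under eq_path => z t do rewrite adj_sym.
exists (dist u x + (dist u y).+1)%N.
  apply/odd_closed_walkP; exists (p ++ y :: rev (belast u q)).
  rewrite cat_path pp last_cat px /= xy; case: rq => -> ->; split => //.
    by rewrite size_cat /= size_rev size_belast psz qsz.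
  by rewrite oddD /= sameP addbN addbb.
have := dist_le_diameter u x; have := dist_le_diameter u y; lia.
Qed.

(** A repetition at two positions of the same parity would cut out a closed
    segment of even length and leave a shorter odd closed walk. *)
Lemma shortest_odd_closed_walk (G : sgraph) (u : G) :
  Defs.connected G -> ~ bipartite G ->
  exists (v : nat -> G) (L : nat),
    [/\ odd L /\ (L <= (2 * diameter G).+1)%N, v 0%N = u /\ v L = u,
        forall i, (i < L)%N -> adj (v i) (v i.+1) &
        forall i j, (i < j <= L)%N -> odd i = odd j -> v i != v j].
Proof.
move=> conG nbip; have [L0 L0w L0le] := odd_closed_walk_exists u conG nbip.
have exL : exists L, odd_closed_walk u L by exists L0.
case: (ex_minnP exL) => L /odd_closed_walkP[p [pp pu psz oL]] Lmin.
have vE i : (i <= L)%N -> nth u (u :: p) i = last u (take i p).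
  rewrite -psz => ile; rewrite (last_nth u) size_takel //.
  by case: i ile => [|i] ile //=; rewrite nth_take.
exists (nth u (u :: p)), L; split.
- by split=> //; exact: leq_trans (Lmin _ L0w) L0le.
- by split=> //; rewrite -[RHS]pu -psz (last_nth u).
- by move=> i; rewrite -psz => ilt; move/(pathP u): pp; apply.
move=> i j /andP[ij jL] par; apply/eqP => vij.
have /Lmin : odd_closed_walk u (i + (L - j)).
  apply/odd_closed_walkP; exists (take i p ++ drop j p).
  have lij : last u (take i p) = last u (take j p) by rewrite -!vE // (leq_trans (ltnW ij)).
  have := pp; rewrite -{1}(cat_take_drop j p) cat_path => /andP[_ pj].
  have := pp; rewrite -{1}(cat_take_drop i p) cat_path => /andP[pi _].
  split.
  - by rewrite cat_path pi lij.
  - by rewrite last_cat lij -last_cat cat_take_drop.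
  - by rewrite size_cat size_takel ?size_drop psz // (leq_trans (ltnW ij)).
  - by rewrite oddD oddB // par oL; case: (odd j).
lia.
Qed.

(** * The lower bound for the spectral gap *)

(** Orient the step leaving an even position forwards and the step leaving an odd
    position backwards: an ordered pair occurs twice only if the walk meets a
    vertex at two positions of the same parity. *)
Lemma walk_energy_le (R : realType) (T : finType) (F : T -> T -> R) (v : nat -> T) L :
  (forall x y, 0 <= F x y) -> (forall x y, F x y = F y x) ->
  (forall i j, (i < j <= L)%N -> odd i = odd j -> v i != v j) ->
  \sum_(i < L) F (v i) (v i.+1) <= \sum_x \sum_y F x y.
Proof.
move=> F0 symF vinj.
pose g (i : 'I_L) := if odd i then (v i.+1, v i) else (v i, v i.+1).
rewrite pair_bigA /=.
have -> : \sum_(i < L) F (v i) (v i.+1) = \sum_(i < L) F (g i).1 (g i).2.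
  by apply: eq_bigr => i _; rewrite /g; case: ifP => //= _; rewrite symF.
apply: (@subsum_inj_le _ _ _ g (fun p => F p.1 p.2)) => // i j gij.
have neq k l : (k < l <= L)%N -> odd k = odd l -> v k = v l -> False.
  by move=> h1 h2 h3; move: (vinj _ _ h1 h2); rewrite h3 eqxx.
have ne (a b : 'I_L) : g a = g b -> (a < b)%N -> False.
  move=> gab lt; have := ltn_ord b; move: gab; rewrite /g.
  case: (boolP (odd a)) => oa; case: (boolP (odd b)) => ob [] h1 h2 bL.
  - by apply: (neq a b); rewrite ?lt ?(ltnW bL) ?oa ?ob.
  - by apply: (neq a b.+1); rewrite ?ltnS ?(ltnW lt) ?bL //= oa (negbTE ob).
  - by apply: (neq a b.+1); rewrite ?ltnS ?(ltnW lt) ?bL //= ob (negbTE oa).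
  - by apply: (neq a b); rewrite ?lt ?(ltnW bL) ?(negbTE oa) ?(negbTE ob).
apply: ord_inj; case: (ltngtP i j) => // [/(ne i j gij)|/(ne j i (esym gij))] //.
Qed.

Lemma exists_large_entry (R : realType) (T : finType) (x : T -> R) :
  sqnorm x = 1 -> exists u, 1 <= #|T|%:R * x u ^+ 2.
Proof.
move=> x1; apply: contrapT => /forallNP no.
have [u0 _] := sqnorm1_neq0 x1.
suff : #|T|%:R * sqnorm x < #|T|%:R by rewrite x1 mulr1 ltxx.
rewrite /sqnorm mulr_sumr -[X in _ < X%:R]sum1_card natr_sum; apply: ltr_sum => [|u _].
  by apply/hasP; exists u0; rewrite ?mem_index_enum.
by rewrite ltNge; apply/negP.
Qed.

(** The strictness comes from the resistance bound, which needs an odd closed walk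
    of length at least 3. *)
Lemma mu_plus_mu_min_lower (R : realType) (G : sgraph) :
  Defs.connected G -> ~ bipartite G ->
  2 / (mu R G ^+ (2 * diameter G) * (Defs.order G)%:R) < mu R G + mu_min R G.
Proof.
move=> conG nbip; set m := mu R G; set D := diameter G.
have [w [_ wE w0]] := perron R conG; rewrite -/m in wE.
have [x [x1 xE _]] := mu_min_spec R G.
have [u xu] := exists_large_entry x1.
have [v [L [[oL LD] [v0 vL] vadj vinj]]] := shortest_odd_closed_walk u conG nbip.
have wN z : w z != 0 by rewrite gt_eqF.
pose f z := x z / w z.
have energy : \sum_y \sum_z adjf R y z * (w y * w z) * (f y + f z) ^+ 2 = 2 * (m + mu_min R G).
  by rewrite (energy_identity x wE w0) (form_eigen xE) x1 !mulr1.
have Fle : \sum_(i < L) adjf R (v i) (v i.+1) * (w (v i) * w (v i.+1)) *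
    (f (v i) + f (v i.+1)) ^+ 2 <= 2 * (m + mu_min R G).
  rewrite -energy; apply: (walk_energy_le (F := fun y z => adjf R y z * (w y * w z) *
    (f y + f z) ^+ 2)) => // y z.
    by rewrite mulr_ge0 ?sqr_ge0 // mulr_ge0 ?adjf_ge0 // mulr_ge0 // ltW.
  by rewrite adjfC [w y * _]mulrC [f y + _]addrC.
(* A closed walk of length 1 would be a loop. *)
have [n Ln] : exists n, L = n.+3.
  case: L oL {LD vinj Fle} vL vadj => [|[|[|n]]] // _ v1 /(_ 0%N isT).
    by rewrite v0 v1 adj_irrefl.
  by exists n.
have m1 : 1 <= m.
  by apply: (@mu_ge1 _ _ (v 0%N) (v 1%N)) => //; apply: vadj; rewrite Ln.
have m0 : 0 < m by exact: lt_le_trans m1.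
have res : scaled_resistance (fun i => w (v i)) L < m ^+ (2 * D).
  rewrite Ln; apply: (@lt_le_trans _ _ (m ^+ n.+2)); last first.
    by rewrite ler_weXn2l //; lia.
  apply: resistance_lt => // i ilt.
  apply: (adjacent_pair_le wE w0); try by apply: vadj; lia.
  by apply: vinj; [lia|rewrite /= negbK].
have S0 : 0 <= \sum_(i < L) (w (v i) * w (v i.+1))^-1.
  by rewrite sumr_ge0 // => i _; rewrite invr_ge0 mulr_ge0 // ltW.
have cauchy : 2 * x u ^+ 2 <= (m + mu_min R G) * scaled_resistance (fun i => w (v i)) L.
  have := @weighted_cauchy R 'I_L (fun i => w (v i) * w (v i.+1))
    (fun i => (-1) ^+ i * (f (v i) + f (v i.+1))) (fun i => mulr_gt0 (w0 _) (w0 _)).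
  rewrite (telescope_odd (fun i => f (v i))) -signr_odd oL v0 vL.
  have -> : \sum_(i < L) w (v i) * w (v i.+1) * ((-1) ^+ i * (f (v i) + f (v i.+1))) ^+ 2 =
      \sum_(i < L) adjf R (v i) (v i.+1) * (w (v i) * w (v i.+1)) * (f (v i) + f (v i.+1)) ^+ 2.
    apply: eq_bigr => i _; rewrite /adjf vadj // mul1r exprMn -exprM mulnC exprM.
    by rewrite sqrrN expr1n expr1n mul1r.
  move=> /le_trans /(_ (ler_wpM2r S0 Fle)).
  rewrite /scaled_resistance v0 vL; set s := \sum_(i < L) _ => h.
  (* The alternating sum equals 2 * f u, and f u * w u = x u; dividing by 2
     accounts for each edge being counted in both orientations. *)
  have -> : 2 * x u ^+ 2 = w u ^+ 2 / 2 * (f u - (-1) ^+ true * f u) ^+ 2.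
    by rewrite /f expr1; field.
  have -> : (m + mu_min R G) * (w u * w u * s) = w u ^+ 2 / 2 * (2 * (m + mu_min R G) * s).
    by field.
  by apply: ler_wpM2l => //; rewrite mulr_ge0 ?sqr_ge0 // invr_ge0.
have n0 : 0 < (Defs.order G)%:R :> R by rewrite ltr0n vertex_gt0.
have xu0 : 0 < 2 * x u ^+ 2.
  rewrite mulr_gt0 // lt_neqAle sqr_ge0 andbT eq_sym; apply/eqP => x0.
  by move: xu; rewrite x0 mulr0 ler10.
have e0 : 0 < m + mu_min R G.
  rewrite ltNge; apply/negP => e0; move: (lt_le_trans xu0 cauchy); apply/negP.
  rewrite -leNgt mulr_le0_ge0 // /scaled_resistance mulr_ge0 // mulr_ge0 // ltW //.
rewrite ltr_pdivrMr ?mulr_gt0 ?exprn_gt0 //.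
apply: (@le_lt_trans _ _ (2 * ((Defs.order G)%:R * x u ^+ 2))).
  by rewrite -[leLHS]mulr1 ler_pM2l.
rewrite mulrCA [ltRHS]mulrA [ltRHS]mulrC ltr_pM2l //.
by apply: (le_lt_trans cauchy); rewrite ltr_pM2l.
Qed.

(** * Level graphs *)

(** The clique on level 0 is the only obstruction to the 2-colouring of the
    vertices by the parity of their level, and distances can be read off the
    levels. *)
Definition level_adj (T : finType) (l : T -> nat) : rel T := fun x y =>
  [|| l x == (l y).+1, l y == (l x).+1 | [&& l x == 0%N, l y == 0%N & x != y]].

Lemma level_adj_sym (T : finType) (l : T -> nat) : symmetric (level_adj l).
Proof. by move=> x y; rewrite /level_adj orbCA andbCA (eq_sym x y). Qed.

Lemma level_adj_irrefl (T : finType) (l : T -> nat) : irreflexive (level_adj l).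
Proof. by move=> x; rewrite /level_adj eqxx !andbF orbF orbb ltn_eqF. Qed.

Definition level_graph (T : finType) (l : T -> nat) (T0 : (0 < #|T|)%N) : sgraph :=
  SGraph (@level_adj_sym T l) (@level_adj_irrefl T l) T0.

Section LevelGraph.
Variables (T : finType) (l : T -> nat) (T0 : (0 < #|T|)%N) (D : nat).
Hypotheses (D2 : (1 < D)%N) (l_le : forall x, (l x <= D)%N).
Hypothesis l_onto : forall i, (i <= D)%N -> exists x, l x = i.

Local Notation G := (level_graph l T0).

Lemma level_up_path d (x y : G) : l y = (l x + d.+1)%N ->
  exists p, [/\ path (@adj G) x p, last x p = y & size p = d.+1].
Proof.
elim: d x => [|d IH] x yE.
  by exists [:: y]; split=> //=; rewrite andbT /level_adj yE addn1 eqxx orbT.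
have [z zE] : exists z, l z = (l x).+1.
  by apply: l_onto; have := l_le y; rewrite yE; lia.
have [|p [pp pz psz]] := IH z; first by rewrite yE zE; lia.
by exists (z :: p); split; rewrite //= ?psz // pp andbT /level_adj zE eqxx orbT.
Qed.

Lemma level_down_path d (x y : G) : l x = (l y + d.+1)%N ->
  exists p, [/\ path (@adj G) x p, last x p = y & size p = d.+1].
Proof.
elim: d x => [|d IH] x xE.
  by exists [:: y]; split=> //=; rewrite andbT /level_adj xE addn1 eqxx.
have [z zE] : exists z, l z = (l x).-1.
  by apply: l_onto; have := l_le x; lia.
have [|p [pp pz psz]] := IH z; first by rewrite zE xE; lia.
exists (z :: p); split; rewrite //= ?psz // pp andbT /level_adj zE.
by rewrite prednK ?eqxx // xE; lia.
Qed.

(** Levels can be climbed or descended one by one; two vertices of the same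
    positive level have a common neighbour one level below, and level 0 is a
    clique. *)
Lemma level_short_path (x y : G) :
  exists p, [/\ path (@adj G) x p, last x p = y & (size p <= D)%N].
Proof.
have := l_le x; have := l_le y => yD xD.
have [lt|gt|eq] := ltngtP (l x) (l y).
- have [|p [pp py psz]] := @level_up_path (l y - l x).-1 x y; first by lia.
  by exists p; rewrite psz; split=> //; lia.
- have [|p [pp py psz]] := @level_down_path (l x - l y).-1 x y; first by lia.
  by exists p; rewrite psz; split=> //; lia.
have [->|xy] := eqVneq x y; first by exists [::].
have [x0|x0] := eqVneq (l x) 0%N.
  exists [:: y]; split=> //=; last exact: ltnW.
  by rewrite andbT /level_adj -eq x0 eqxx xy !orbT.
have [z zE] := @l_onto (l x).-1 (leq_trans (leq_pred _) xD).
exists [:: z; y]; split=> //=.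
by rewrite /level_adj -eq zE prednK ?lt0n // eqxx orbT.
Qed.

(** An edge changes the level by at most 1; this bounds from below the distance
    from level [D] to level 0. *)
Lemma level_path_lipschitz (x : G) p :
  path (@adj G) x p -> (l x <= l (last x p) + size p)%N.
Proof.
elim: p x => [|y p IH] x /=; first by rewrite addn0.
move=> /andP[xy /IH]; move: xy; rewrite /level_adj.
move: (l x) (l y) (l (last y p)) (size p) => a b c d.
by case/or3P=> [/eqP|/eqP|/and3P[/eqP + _ _]]; lia.
Qed.

Lemma level_graph_connected : Defs.connected G.
Proof.
by move=> x y; have [p [pp py _]] := level_short_path x y; apply/connectP; exists p.
Qed.

Lemma level_graph_diameter : diameter G = D.
Proof.
apply/eqP; rewrite eqn_leq; apply/andP; split.
  apply/bigmax_leqP => x _; apply/bigmax_leqP => y _.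
  have [p [pp py psz]] := level_short_path x y.
  exact: leq_trans (dist_le pp py) psz.
have [x xD] := l_onto (leqnn D); have [y y0] := l_onto (leq0n D).
have [p [pp py psz]] := @dist_path G x y level_graph_connected.
have := level_path_lipschitz pp; rewrite py psz y0 xD => /leq_trans; apply.
exact: dist_le_diameter.
Qed.

(** The two vertices of level 0 and any vertex of level 1 form a triangle. *)
Lemma level_graph_nonbipartite (x y : T) :
  l x = 0%N -> l y = 0%N -> x != y -> ~ bipartite G.
Proof.
move=> x0 y0 xy [A AP].
have [z z1] := l_onto (ltnW D2).
move: (AP x y) (AP x z) (AP y z).
rewrite /= /level_adj x0 y0 z1 xy /= => /(_ isT) + /(_ isT) + /(_ isT).
by case: (x \in A) (y \in A) (z \in A) => [] [] [].
Qed.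

(** Test the smallest eigenvalue with [w] multiplied by the parity sign of the
    level: the edges between levels contribute opposite amounts to the two
    Rayleigh quotients, so only the edges inside level 0 remain. *)
Lemma level_graph_mu_min_le (R : realType) (w : G -> R) :
  sqnorm w = 1 -> (forall u, \sum_v adjf R u v * w v = mu R G * w u) ->
  mu R G + mu_min R G <=
    2 * \sum_(u | l u == 0%N) \sum_(v | (l v == 0%N) && (u != v)) w u * w v.
Proof.
move=> w1 wE; have [_ [_ _ minle]] := mu_min_spec R G.
pose s (u : G) : R := (-1) ^+ l u.
have s2 u : s u ^+ 2 = 1 by rewrite -exprM mulnC exprM sqrrN !expr1n.
have := minle (fun u => s u * w u).
have -> : sqnorm (fun u => s u * w u) = 1.
  by rewrite -w1; apply: eq_bigr => u _; rewrite exprMn s2 mul1r.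
rewrite mulr1 => minle'.
have -> : mu R G = form (@adjf R G) w w by rewrite (form_eigen wE) w1 mulr1.
apply: (le_trans (lerD (lexx _) minle')).
rewrite le_eqVlt; apply/orP; left; apply/eqP.
rewrite mulr_sumr [RHS]big_mkcond /form -big_split; apply: eq_bigr => u _ /=.
have [u0|u0] := eqVneq (l u) 0%N.
  rewrite mulr_sumr [RHS]big_mkcond -big_split; apply: eq_bigr => v _ /=.
  rewrite /adjf /s /= /level_adj u0 /=.
  case: (l v) => [|[|i]] /=; last by rewrite !mul0r addr0.
    by case: (u != v) => /=; rewrite ?expr0; ring.
  by rewrite expr1 expr0; ring.
rewrite -big_split big1 // => v _; rewrite /adjf /s /= /level_adj (negbTE u0) /= orbF.
case: eqP => [->|_] /=.
  by transitivity ((1 - s v ^+ 2) * (w u * w v));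
    [rewrite /s exprS; ring|rewrite s2 subrr mul0r].
case: eqP => [->|_] /=.
  by transitivity ((1 - s u ^+ 2) * (w u * w v));
    [rewrite /s exprS; ring|rewrite s2 subrr mul0r].
by rewrite !mul0r addr0.
Qed.

End LevelGraph.

Lemma eigen_sum_ge (R : realType) (G : sgraph) (w : G -> R) (c : R) (I : finType)
    (g : I -> G) (x : G) :
  (forall u, \sum_v adjf R u v * w v = c * w u) -> (forall u, 0 < w u) ->
  injective g -> (forall i, adj x (g i)) -> \sum_i w (g i) <= c * w x.
Proof.
move=> wE w0 ginj xg; rewrite -wE.
have -> : \sum_i w (g i) = \sum_i adjf R x (g i) * w (g i).
  by apply: eq_bigr => i _; rewrite /adjf xg mul1r.
apply: (@subsum_inj_le _ _ _ g (fun v => adjf R x v * w v)) => // v.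
by rewrite mulr_ge0 ?adjf_ge0 // ltW.
Qed.

Lemma eigen_sum_le (R : realType) (G : sgraph) (w : G -> R) (c : R) (s : seq G) (x : G) :
  (forall u, \sum_v adjf R u v * w v = c * w u) -> (forall u, 0 < w u) ->
  uniq s -> (forall v, adj x v -> v \in s) -> c * w x <= \sum_(v <- s) w v.
Proof.
move=> wE w0 us xs; rewrite -wE [leRHS]big_uniq //= [leRHS]big_mkcond; apply: ler_sum => v _.
rewrite /adjf; have := xs v; case: adj => [/(_ isT) ->|_]; first by rewrite mul1r.
by rewrite mul0r; case: ifP => // _; exact: ltW.
Qed.

(** Summing the eigenvalue equation of the Perron vector over each side gives
    [k.+1 * SA <= mu * SB] and [k.+1 * SB < mu * SA], the second one strict
    because of the extra neighbour [z]. *)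
Lemma mu_gt_complete_bipartite (R : realType) (G : sgraph) k (a b : 'I_k.+1 -> G) (z : G) :
  Defs.connected G -> injective a -> injective b ->
  (forall i j, adj (a i) (b j)) -> adj (a ord0) z -> (forall j, b j != z) ->
  k.+1%:R < mu R G.
Proof.
move=> conG ainj binj ab az bz; have [w [_ wE w0]] := perron R conG.
set m := mu R G in wE *.
pose SA := \sum_i w (a i); pose SB := \sum_j w (b j).
have SA0 : 0 < SA by rewrite /SA big_ord_recl ltr_pwDl // sumr_ge0 // => i _; exact: ltW.
have SB0 : 0 < SB by rewrite /SB big_ord_recl ltr_pwDl // sumr_ge0 // => i _; exact: ltW.
have hB : k.+1%:R * SA <= m * SB.
  rewrite /SB [leRHS]mulr_sumr mulr_natl -[X in SA *+ X]card_ord -sumr_const.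
  by apply: ler_sum => j _; apply: eigen_sum_ge => // i; rewrite adj_sym.
have hA : k.+1%:R * SB < m * SA.
  rewrite /SA [ltRHS]mulr_sumr mulr_natl -[X in SB *+ X]card_ord -sumr_const.
  rewrite !big_ord_recl; apply: ltr_leD; last first.
    by apply: ler_sum => j _; apply: eigen_sum_ge => // i; rewrite adj_sym.
  (* The neighbours b j of a 0 together with the additional neighbour z. *)
  pose g (o : option 'I_k.+1) := if o is Some j then b j else z.
  have ginj : injective g.
    move=> [i|] [j|] //=; first by move/binj ->.
      by move/eqP; rewrite (negbTE (bz i)).
    by move/esym/eqP; rewrite (negbTE (bz j)).
  have := @eigen_sum_ge R G w m _ g (a ord0) wE w0 ginj.
  have -> : \sum_o w (g o) = w z + SB.
    rewrite (bigD1 None) //=; congr (_ + _).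
    rewrite (reindex_omap Some id) /=; last by case.
    by apply: eq_bigl => j; rewrite eqxx.
  move=> h; apply: lt_le_trans (h _); first by rewrite ltrDr.
  by case=> [j|] /=.
rewrite -(ltr_pM2r (addr_gt0 SA0 SB0)) !mulrDr; lra.
Qed.

(** * Complete bipartite graphs with a tail ending in a triangle *)

(** Growth by a factor [m - 1 >= 2] propagates: [2 * U i <= U i.+1] turns the
    recursion into [(m - 1) * U i.+1 <= U i.+2]. *)
Lemma geometric_growth (R : realType) (U : nat -> R) (m : R) n :
  3 <= m -> 0 <= U 0%N -> (m - 1) * U 0%N <= U 1%N ->
  (forall i, (i < n)%N -> m * U i.+1 <= 2 * U i + U i.+2) ->
  (m - 1) ^+ n.+1 * U 0%N <= U n.+1.
Proof.
move=> m3 U0 U01 Urec.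
have step i : (i <= n)%N -> 0 <= U i /\ (m - 1) * U i <= U i.+1.
  elim: i => [|i IH] ile; first by [].
  have [Ui0 Uile] := IH (ltnW ile).
  have h2 : 2 * U i <= U i.+1.
    by apply: le_trans Uile; rewrite ler_wpM2r //; lra.
  have := Urec i ile.
  by split; lra.
have : forall i, (i <= n.+1)%N -> (m - 1) ^+ i * U 0%N <= U i.
  elim=> [|i IH] ile; first by rewrite mul1r.
  have [_] := step i ile; apply: le_trans.
  rewrite exprS -mulrA ler_wpM2l ?IH 1?ltnW //; lra.
exact.
Qed.

(** Level sizes are 2, then 1 on each of the levels 1 to [D - 2], then [k] on
    level [D - 1] and [k - 1] on level [D].  The triangle consists of the vertices
    0, 1, 2; vertex [D - 1] lies on level [D - 2] and together with level [D]
    is the side of the complete bipartite graph opposite to level [D - 1]. *)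
Definition tail_level (k D v : nat) : nat := if (v < D + k)%N then minn v.-1 D.-1 else D.

Section Tail.
Variables (k D : nat).
Hypotheses (k3 : (3 <= k)%N) (D4 : (4 <= D)%N).

Local Notation N := (D + 2 * k - 2)%N.
Local Notation l := (fun v : 'I_N.+1 => tail_level k D v).

Let T0 : (0 < #|'I_N.+1|)%N.
Proof. by rewrite card_ord. Qed.

Definition tail_graph := level_graph l T0.

Let tail_le (v : 'I_N.+1) : (l v <= D)%N.
Proof. by rewrite /tail_level; case: ifP => _; lia. Qed.

Let tail_onto i : (i <= D)%N -> exists v : 'I_N.+1, l v = i.
Proof.
move=> iD; exists (inord (if i == D then D + k else i.+1)).
rewrite inordK; last by case: eqP; lia.
by rewrite /tail_level; case: eqP => [->|ne]; case: ifP; lia.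
Qed.

Lemma tail_connected : Defs.connected tail_graph.
Proof. by apply: level_graph_connected tail_le tail_onto; lia. Qed.

Lemma tail_diameter : diameter tail_graph = D.
Proof. by apply: level_graph_diameter tail_le tail_onto; lia. Qed.

Lemma tail_order : Defs.order tail_graph = (D + 2 * k - 1)%N.
Proof. by rewrite /Defs.order /= card_ord; lia. Qed.

Lemma inord_eq i j : (i <= N)%N -> (j <= N)%N ->
  (inord i == inord j :> 'I_N.+1) = (i == j).
Proof. by move=> iN jN; rewrite -val_eqE /= !inordK. Qed.

Lemma tail_nonbipartite : ~ bipartite tail_graph.
Proof.
apply: (@level_graph_nonbipartite _ _ T0 D _ tail_onto (inord 0) (inord 1)).
- lia.
- by rewrite inordK //; rewrite /tail_level; case: ifP; lia.
- by rewrite inordK; [rewrite /tail_level; case: ifP; lia|lia].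
- by rewrite inord_eq //; lia.
Qed.

Lemma tail_mu_gt (R : realType) : k%:R < mu R tail_graph.
Proof.
have -> : k = k.-1.+1 by lia.
(* Side a is vertex D - 1 with level D, side b is level D - 1, and the extra
   neighbour is vertex D - 2 on the tail. *)
pose a (i : 'I_k.-1.+1) : 'I_N.+1 := inord (if i == 0%N :> nat then D.-1 else D + k + i.-1).
pose b (i : 'I_k.-1.+1) : 'I_N.+1 := inord (D + i).
have ai (i : 'I_k.-1.+1) : ((if i == 0%N :> nat then D.-1 else D + k + i.-1) < N.+1)%N.
  by have := ltn_ord i; case: eqP; lia.
have bi (i : 'I_k.-1.+1) : (D + i < N.+1)%N by have := ltn_ord i; lia.
apply: (@mu_gt_complete_bipartite R tail_graph k.-1 a b (inord D.-2)).
- exact: tail_connected.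
- move=> i j /(congr1 val); rewrite /= !inordK // => ij; apply: ord_inj; move: ij.
  by case: eqP; case: eqP; lia.
- by move=> i j /(congr1 val); rewrite /= !inordK // => /addnI ij; apply: ord_inj.
- move=> i j; rewrite /= /level_adj /a /b !inordK // /tail_level.
  have := ltn_ord i; have := ltn_ord j.
  by case: (eqVneq (i : nat) 0%N) => [i0|i0]; case: ifP; case: ifP; lia.
- rewrite /= /level_adj /a /= !inordK; try lia.
  by rewrite /tail_level; case: ifP; case: ifP; lia.
- by move=> j; have jk := ltn_ord j; rewrite inord_eq; lia.
Qed.

(** Writing [s] for the mean of the entries 0 and 1, the gap is at most
    [4 * s ^ 2], while [(mu - 1) ^ (D - 2) * s <= W (D - 1) <= 1]. *)
Lemma tail_gap_lt (R : realType) :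
  mu R tail_graph + mu_min R tail_graph < 4 / (k%:R - 1) ^+ (2 * D - 4).
Proof.
have D2 : (D - 2 != 0)%N by lia.
have D24 : (2 * D - 4 = (D - 2) * 2)%N by lia.
have l0 (v : 'I_N.+1) : (tail_level k D v == 0%N) = (v \in [:: inord 0; inord 1]).
  rewrite !inE -!val_eqE /= !inordK //; last by lia.
  by have := ltn_ord v; rewrite /tail_level; case: ifP; lia.
have u01 : uniq [:: inord 0; inord 1 : 'I_N.+1] by rewrite /= inE inord_eq //; lia.
have n01 : inord 0 != inord 1 :> 'I_N.+1 by rewrite inord_eq //; lia.
have [w [w1 wE w0]] := perron R tail_connected.
have km := tail_mu_gt R; set m := mu R tail_graph in wE km *.
pose W i : R := w (inord i : 'I_N.+1).
have W0 i : 0 < W i by exact: w0.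
have nbrs i (s : seq nat) : (i <= N)%N -> uniq s -> all (fun j => j <= N)%N s ->
    (forall j, (j <= N)%N -> [|| tail_level k D i == (tail_level k D j).+1,
       tail_level k D j == (tail_level k D i).+1 |
       [&& tail_level k D i == 0%N, tail_level k D j == 0%N & i != j]] -> j \in s) ->
    m * W i <= \sum_(j <- s) W j.
  move=> iN us sN sP.
  rewrite -(big_map (fun j => inord j : 'I_N.+1) xpredT w).
  apply: eigen_sum_le wE w0 _ _ => [|v].
    rewrite map_inj_in_uniq // => x y /(allP sN) xN /(allP sN) yN /eqP.
    by rewrite inord_eq // => /eqP.
  rewrite /= /level_adj inordK // -val_eqE /= inordK // => iv.
  by rewrite -(inord_val v); apply: map_f; apply: sP iv; rewrite -ltnS.
have h0 : m * W 0%N <= W 1%N + W 2%N.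
  have := nbrs 0%N [:: 1; 2]%N isT isT; rewrite big_cons big_seq1; apply.
    by rewrite /=; lia.
  by move=> j jN; rewrite !inE /tail_level; case: ifP; case: ifP; lia.
have h1 : m * W 1%N <= W 0%N + W 2%N.
  have := nbrs 1%N [:: 0; 2]%N _ isT; rewrite big_cons big_seq1; apply; first by lia.
    by rewrite /=; lia.
  by move=> j jN; rewrite !inE /tail_level; case: ifP; case: ifP; lia.
have h2 : m * W 2%N <= W 0%N + W 1%N + W 3%N.
  have := nbrs 2%N [:: 0; 1; 3]%N _ isT; rewrite !big_cons big_nil addr0 addrA; apply; first by lia.
    by rewrite /=; lia.
  by move=> j jN; rewrite !inE /tail_level; case: ifP; case: ifP; lia.
have hi i : (3 <= i <= D - 2)%N -> m * W i <= W i.-1 + W i.+1.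
  move=> iD; have := nbrs i [:: i.-1; i.+1]%N; rewrite big_cons big_seq1; apply.
  - lia.
  - by rewrite /= inE; lia.
  - by rewrite /=; lia.
  by move=> j jN; rewrite !inE /tail_level; case: ifP; case: ifP; lia.
pose s := (W 0%N + W 1%N) / 2.
have s0 : 0 < s by rewrite divr_gt0 // addr_gt0.
have k3R : 3 <= k%:R :> R by rewrite (ler_nat R 3).
have k1 : 0 < k%:R - 1 :> R by lra.
have growth : (m - 1) ^+ (D - 2) * s <= W D.-1.
  (* The two vertices of level 0 are merged into one term, their mean s, which
     accounts for the factor 2 in the recursion at vertex 2. *)
  pose U i := if i is i'.+1 then W i'.+2 else s.
  have := @geometric_growth R U m (D - 3).
  rewrite (_ : (D - 3).+1 = D - 2)%N; last by lia.
  rewrite (_ : U (D - 2)%N = W D.-1); last first.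
    by rewrite /U (_ : D - 2 = (D - 3).+1)%N; [congr W; lia|lia].
  apply.
  - lra.
  - exact: ltW.
  - by rewrite /U /s; lra.
  case=> [|i] ilt; rewrite /U; first by rewrite /s; lra.
  have iD : (3 <= i.+3 <= D - 2)%N by lia.
  by have := hi _ iD; have := W0 i.+2; rewrite [i.+3.-1]/=; lra.
have WD1 : W D.-1 <= 1.
  rewrite -(@expr_le1 _ 2) //; last exact: ltW.
  by rewrite -w1 /sqnorm (bigD1 (inord D.-1 : 'I_N.+1)) //= lerDl sumr_ge0 // => v _; rewrite sqr_ge0.
have gap : m + mu_min R tail_graph <= 4 * (W 0%N * W 1%N).
  have := level_graph_mu_min_le w1 wE; move/le_trans; apply.
  rewrite (eq_bigl _ _ l0) -big_uniq // big_cons big_seq1.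
  rewrite (big_pred1 (inord 1)) => [|v]; last first.
    rewrite l0 !inE [inord 0 == v]eq_sym.
    by case: (eqVneq v (inord 0)) => [->|_]; rewrite ?andbT ?andbF ?(negbTE n01).
  rewrite (big_pred1 (inord 0)) => [|v]; last first.
    rewrite l0 !inE [inord 1 == v]eq_sym [_ || _]orbC.
    by case: (eqVneq v (inord 1)) => [->|_];
      rewrite ?andbT ?andbF // [RHS]eq_sym (negbTE n01).
  by rewrite le_eqVlt; apply/orP; left; apply/eqP; rewrite /W /=; ring.
have sq : W 0%N * W 1%N <= s ^+ 2.
  rewrite -subr_ge0 (_ : _ - _ = ((W 0%N - W 1%N) / 2) ^+ 2) ?sqr_ge0 //.
  by rewrite /s; field.
set q := (k%:R - 1) ^+ (D - 2) : R.
have q0 : 0 < q by rewrite exprn_gt0.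
have qs : q * s < 1.
  apply: lt_le_trans (le_trans growth WD1); rewrite ltr_pM2r // ltrXn2r ?(ltW k1) //; lra.
rewrite D24 exprM -/q; apply: (le_lt_trans gap); rewrite ltr_pM2l //.
apply: (le_lt_trans sq); rewrite -[ltRHS]mul1r ltr_pdivlMr ?exprn_gt0 //.
by rewrite -exprMn mulrC expr_lt1 // mulr_ge0 // ltW.
Qed.

End Tail.

Theorem theorem2 (R : realType) :
  (forall (G : sgraph) (n D : nat),
     Defs.connected G -> ~ bipartite G ->
     Defs.order G = n -> diameter G = D ->
     2 / (mu R G ^+ (2 * D) * n%:R) < mu R G + mu_min R G)
  /\
  (forall k D n : nat,
     (3 <= k)%N -> (4 <= D)%N -> n = (D + 2 * k - 1)%N ->
     exists G : sgraph,
       [/\ Defs.connected G /\ ~ bipartite G,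
           Defs.order G = n,
           diameter G = D,
           k%:R < mu R G &
           mu R G + mu_min R G < 4 / (k%:R - 1) ^+ (2 * D - 4)]).
Proof.
split=> [G _ _ conG nbip <- <-|k D _ k3 D4 ->]; first exact: mu_plus_mu_min_lower.
exists (tail_graph k D); split.
- by split; [exact: tail_connected|exact: tail_nonbipartite].
- exact: tail_order.
- exact: tail_diameter.
- exact: tail_mu_gt.
- exact: tail_gap_lt.
Qed.
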